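(* (Hölder inequality) Let $f\in\mathcal A_c(\mathbb R^2)$ and $g\in\mathcal{HKBV}(\overline{\mathbb R}^2)$. Then for all $[a,b]\times[c,d]\subseteq\overline{\mathbb R}^2$ and all $(x,y)\in\overline{\mathbb R}^2$, $$\left|\int_a^b\int_c^dfg\right|\le\lVert f\rVert\left(4\lVert g\rVert_\infty+2\lVert V_1g\rVert_\infty+2\lVert V_2g\rVert_\infty+V_{12}g\right),$$ $$\left|\int_{-\infty}^x\int_{-\infty}^yfg\right|\le\lVert f\rVert\left(\lVert g\rVert_\infty+\lVert V_1g\rVert_\infty+\lVert V_2g\rVert_\infty+V_{12}g\right)=\lVert f\rVert\,\lVert g\rVert_{bv}.$$
   Context: $\overline{\mathbb R}=[-\infty,\infty]$ is the two-point compactification of $\mathbb R$, and $\overline{\mathbb R}^2$ carries the product topology. $\mathcal B_c(\overline{\mathbb R}^2)$ is the set of continuous $F:\overline{\mathbb R}^2\to\mathbb R$ with $F(-\infty,s)=F(s,-\infty)=0$ for all $s\in\overline{\mathbb R}$. $\partial_{12}=\partial_1\partial_2$ is the distributional derivative on $\mathbb R^2$, and $\mathcal A_c(\mathbb R^2)=\{\partial_{12}F\mid F\in\mathcal B_c(\overline{\mathbb R}^2)\}\subset\mathcal D'(\mathbb R^2)$; the primitive $F$ of $f=\partial_{12}F$ is unique and the Alexiewicz norm is $\lVert f\rVert=\lVert F\rVert_\infty$. Hardy--Krause variation: a division of $\overline{\mathbb R}^2$ is a finite collection of closed intervals with union $\overline{\mathbb R}^2$ whose pairwise intersections have planar Lebesgue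 measure zero. For $g:\overline{\mathbb R}^2\to\mathbb R$, $V_{12}g=\sup\sum_i|g(a_i,c_i)+g(b_i,d_i)-g(a_i,d_i)-g(b_i,c_i)|$ over all divisions $\{[a_i,b_i]\times[c_i,d_i]\}$ of $\overline{\mathbb R}^2$; $V_1g(\cdot,y_0)$ and $V_2g(x_0,\cdot)$ are the one-variable total variations over $\overline{\mathbb R}$ of $x\mapsto g(x,y_0)$ and $y\mapsto g(x_0,y)$. $\mathcal{HKBV}(\overline{\mathbb R}^2)$ is the set of $g$ with $V_{12}g<\infty$ and, for some $x_0,y_0\in\overline{\mathbb R}$, $V_1g(\cdot,y_0)<\infty$ and $V_2g(x_0,\cdot)<\infty$. Here $\lVert V_1g\rVert_\infty=\sup_{y}V_1g(\cdot,y)$, $\lVert V_2g\rVert_\infty=\sup_xV_2g(x,\cdot)$ (finite for $g\in\mathcal{HKBV}$), and $\lVert g\rVert_{bv}=\lVert g\rVert_\infty+\lVert V_1g\rVert_\infty+\lVert V_2g\rVert_\infty+V_{12}g$, with $\lVert\cdot\rVert_\infty$ the supremum. Stieltjes integrals are Henstock--Stieltjes integrals: a gauge $\gamma$ assigns to each point an open set containing it (contained in $\mathbb R^2$ for points of $\mathbb R^2$); a tagged division $\{[a_i,b_i]\times[c_i,d_i],(x_i,y_i)\}$ (tag in its interval) is $\gamma$-fine if each interval is contained in $\gamma$ of its tag; $\iint F\,d_{12}g=A$ means for every $\epsilon>0$ there is a gauge $\gamma$ such that $|\sum_iF(x_i,y_i)[g(a_i,c_i)+g(b_i,d_i)-g(a_i,d_i)-g(b_i,c_i)]-A|<\epsilon$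 for each $\gamma$-fine tagged division of the interval of integration. $d_1$ and $d_2$ denote the analogous one-variable integrals with respect to the first, resp. second, variable. The integral of the product $fg$ is defined by integration by parts: for $f\in\mathcal A_c(\mathbb R^2)$ with primitive $F$, $g\in\mathcal{HKBV}(\overline{\mathbb R}^2)$ and $[a,b]\times[c,d]\subseteq\overline{\mathbb R}^2$, $$\int_a^b\int_c^dfg:=F(a,c)g(a,c)+F(b,d)g(b,d)-F(a,d)g(a,d)-F(b,c)g(b,c)-\int_a^bF(x,d)\,d_1g(x,d)+\int_a^bF(x,c)\,d_1g(x,c)-\int_c^dF(b,y)\,d_2g(b,y)+\int_c^dF(a,y)\,d_2g(a,y)+\int_a^b\int_c^dF(x,y)\,d_{12}g(x,y).$$ *)

(* Defs.v *)
From HB Require Import structures.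
From mathcomp Require Export all_boot all_order all_algebra.
From mathcomp Require Export all_classical all_reals all_analysis.
Export Order.TTheory GRing.Theory Num.Theory numFieldNormedType.Exports.

Set Implicit Arguments.
Unset Strict Implicit.
Unset Printing Implicit Defensive.

Local Open Scope classical_set_scope.
Local Open Scope ring_scope.

(** * Distributions on the plane *)

Section distributions.
Context {R : realType}.

Definition partial1 (h : R * R -> R) : R * R -> R :=
  fun z => 'D_((1, 0) : R * R) h z.

Definition partial2 (h : R * R -> R) : R * R -> R :=
  fun z => 'D_((0, 1) : R * R) h z.

(* Iterated partial derivatives; [false] stands for the first variable and
   [true] for the second one, the head of the list being applied last. *)
Definition iter_partial (s : seq bool) (h : R * R -> R) : R * R -> R :=
  foldr (fun i => if i then partial2 else partial1) h s.

Definition smooth (h : R * R -> R) : Prop :=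
  forall s : seq bool,
    continuous (iter_partial s h) /\
    forall z : R * R, derivable (iter_partial s h) z (1, 0) /\
                      derivable (iter_partial s h) z (0, 1).

Definition support (h : R * R -> R) : set (R * R) :=
  closure [set z | h z <> 0].

Record test_function := TestFunction {
  test_fun :> R * R -> R ;
  test_smooth : smooth test_fun ;
  test_compact : compact (support test_fun) }.

(* The test functions are not given a module structure here: linearity refers
   to an arbitrary test function that is pointwise equal to the combination. *)
Definition distr_linear (T : test_function -> R) : Prop :=
  forall (a : R) (p q r : test_function),
    (forall z, r z = a * p z + q z) -> T r = a * T p + T q.

Definition test_cvg0 (p : nat -> test_function) : Prop :=
  (exists K : set (R * R), compact K /\ forall n, support (p n) `<=` K) /\
  forall (s : seq bool) (e : R), 0 < e ->
    \forall n \near \oo, forall z, `|iter_partial s (p n) z| < e.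

Record distribution := Distribution {
  distr :> test_function -> R ;
  distr_lin : distr_linear distr ;
  distr_continuous : forall p : nat -> test_function,
    test_cvg0 p -> (fun n => distr (p n)) @ \oo --> (0 : R) }.

(* <d12 F, phi> = (-1)^2 <F, d12 phi>, with F seen as the regular distribution
   given by its restriction to the finite points. *)
Definition distr_d12 (f : distribution) (F : \bar R * \bar R -> R) : Prop :=
  forall p : test_function,
    f p = \int[(@lebesgue_measure R \x @lebesgue_measure R)%E]_z
            (F (z.1%:E, z.2%:E) * partial1 (partial2 p) z).

(** * Primitives and the Alexiewicz norm *)

Definition Bc : set (\bar R * \bar R -> R) :=
  [set F | continuous F /\
           forall s : \bar R, F (-oo%E, s) = 0 /\ F (s, -oo%E) = 0].

Definition Ac : set distribution :=
  [set f | exists2 F, Bc F & distr_d12 f F].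

(* For [f] in [Ac] this is the unique primitive of [f]. *)
Definition primitive (f : distribution) : \bar R * \bar R -> R :=
  xget (fun=> 0) [set F | Bc F /\ distr_d12 f F].

(* [fine] is only applied to suprema that are finite on [Bc] and [HKBV]. *)
Definition supnorm {T : Type} (h : T -> R) : R :=
  fine (ereal_sup (range (fun z => `|h z|%:E))).

Definition anorm (f : distribution) : R := supnorm (primitive f).

End distributions.

(** * Divisions and variations *)

Section variation.
Context {R : realType}.

Definition seg : Type := (\bar R * \bar R)%type.
Definition box : Type := (seg * seg)%type.

Definition seg_set (I : seg) : set (\bar R) := `[I.1, I.2]%classic.
Definition box_set (J : box) : set (\bar R * \bar R) :=
  seg_set J.1 `*` seg_set J.2.

Definition seg_wf (I : seg) : Prop := (I.1 <= I.2)%E.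
Definition box_wf (J : box) : Prop := seg_wf J.1 /\ seg_wf J.2.

(* Lebesgue measure on the line (resp. the plane) ignores points at infinity. *)
Definition null1 (A : set (\bar R)) : Prop :=
  @lebesgue_measure R [set x | A x%:E] = 0%E.

Definition null2 (A : set (\bar R * \bar R)) : Prop :=
  (@lebesgue_measure R \x @lebesgue_measure R)%E
    [set z : R * R | A (z.1%:E, z.2%:E)] = 0%E.

Definition division1 (I : seg) (n : nat) (D : 'I_n -> seg) : Prop :=
  [/\ forall i, seg_wf (D i),
      \bigcup_i seg_set (D i) = seg_set I &
      forall i j, i != j -> null1 (seg_set (D i) `&` seg_set (D j))].

Definition division2 (J : box) (n : nat) (D : 'I_n -> box) : Prop :=
  [/\ forall i, box_wf (D i),
      \bigcup_i box_set (D i) = box_set J &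
      forall i j, i != j -> null2 (box_set (D i) `&` box_set (D j))].

Definition whole1 : seg := (-oo%E, +oo%E).
Definition whole2 : box := (whole1, whole1).

Definition incr1 (h : \bar R -> R) (I : seg) : R := h I.2 - h I.1.

Definition incr2 (g : \bar R * \bar R -> R) (J : box) : R :=
  let: ((a, b), (c, d)) := J in g (a, c) + g (b, d) - g (a, d) - g (b, c).

Definition V (h : \bar R -> R) : \bar R :=
  ereal_sup [set v | exists n (D : 'I_n -> seg),
    division1 whole1 D /\ v = (\sum_(i < n) `|incr1 h (D i)|)%:E].

Definition V12 (g : \bar R * \bar R -> R) : \bar R :=
  ereal_sup [set v | exists n (D : 'I_n -> box),
    division2 whole2 D /\ v = (\sum_(i < n) `|incr2 g (D i)|)%:E].

Definition V1 (g : \bar R * \bar R -> R) (y : \bar R) : \bar R :=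
  V (fun x => g (x, y)).

Definition V2 (g : \bar R * \bar R -> R) (x : \bar R) : \bar R :=
  V (fun y => g (x, y)).

Definition HKBV : set (\bar R * \bar R -> R) :=
  [set g | (V12 g < +oo)%E /\
           exists x0 y0, (V1 g y0 < +oo)%E /\ (V2 g x0 < +oo)%E].

Definition V12norm (g : \bar R * \bar R -> R) : R := fine (V12 g).
Definition V1norm (g : \bar R * \bar R -> R) : R :=
  fine (ereal_sup (range (V1 g))).
Definition V2norm (g : \bar R * \bar R -> R) : R :=
  fine (ereal_sup (range (V2 g))).

Definition bvnorm (g : \bar R * \bar R -> R) : R :=
  supnorm g + V1norm g + V2norm g + V12norm g.

End variation.
Arguments seg : clear implicits.
Arguments box : clear implicits.

(** * Henstock-Stieltjes integrals *)

Section henstock_stieltjes.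
Context {R : realType}.

Definition gauge1 (gam : \bar R -> set (\bar R)) : Prop :=
  forall x, [/\ open (gam x), gam x x &
    x \is a fin_num -> gam x `<=` [set y | y \is a fin_num]].

Definition gauge2 (gam : \bar R * \bar R -> set (\bar R * \bar R)) : Prop :=
  forall z, [/\ open (gam z), gam z z &
    z.1 \is a fin_num -> z.2 \is a fin_num ->
    gam z `<=` [set w | w.1 \is a fin_num /\ w.2 \is a fin_num]].

Definition is_HS1 (F g : \bar R -> R) (I : seg R) (A : R) : Prop :=
  forall e : R, 0 < e -> exists2 gam, gauge1 gam &
    forall (n : nat) (D : 'I_n -> seg R) (t : 'I_n -> \bar R),
      division1 I D -> (forall i, seg_set (D i) (t i)) ->
      (forall i, seg_set (D i) `<=` gam (t i)) ->
      `|\sum_(i < n) F (t i) * incr1 g (D i) - A| < e.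

Definition is_HS2 (F g : \bar R * \bar R -> R) (J : box R) (A : R) : Prop :=
  forall e : R, 0 < e -> exists2 gam, gauge2 gam &
    forall (n : nat) (D : 'I_n -> box R) (t : 'I_n -> \bar R * \bar R),
      division2 J D -> (forall i, box_set (D i) (t i)) ->
      (forall i, box_set (D i) `<=` gam (t i)) ->
      `|\sum_(i < n) F (t i) * incr2 g (D i) - A| < e.

(* Values of the integrals, with the convention 0 if an integral does not
   exist (this does not happen for F in [Bc] and g in [HKBV]). *)
Definition HS1 (F g : \bar R -> R) (a b : \bar R) : R :=
  xget 0 [set A | is_HS1 F g (a, b) A].

Definition HS2 (F g : \bar R * \bar R -> R) (a b c d : \bar R) : R :=
  xget 0 [set A | is_HS2 F g ((a, b), (c, d)) A].

(* The integral of f g over [a, b] x [c, d]. *)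
Definition prod_integral (f : distribution) (g : \bar R * \bar R -> R)
    (a b c d : \bar R) : R :=
  let F := primitive f in
  F (a, c) * g (a, c) + F (b, d) * g (b, d)
    - F (a, d) * g (a, d) - F (b, c) * g (b, c)
    - HS1 (fun x => F (x, d)) (fun x => g (x, d)) a b
    + HS1 (fun x => F (x, c)) (fun x => g (x, c)) a b
    - HS1 (fun y => F (b, y)) (fun y => g (b, y)) c d
    + HS1 (fun y => F (a, y)) (fun y => g (a, y)) c d
    + HS2 F g a b c d.

End henstock_stieltjes.

(* Main.v *)
Require Import Defs.
From mathcomp Require Import ring lra.

Set Implicit Arguments.
Unset Strict Implicit.
Unset Printing Implicit Defensive.

Local Open Scope classical_set_scope.
Local Open Scope ring_scope.

(** The estimate needs no existence theorem for the integrals.  A value [A] of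
    an integral of [F] against [dg] is within [e] of the sum attached to any
    fine tagged division, and such a sum is at most [sup |F|] times the
    variation of [g]; so [|A| <= sup |F| * V g] as soon as every gauge admits a
    fine tagged division ([stieltjes_bound]), and the bound is trivial where
    [HS1] and [HS2] take their default value 0.  Summing the nine terms of the
    formula for the integral of [f g] gives the first inequality.  When the
    lower endpoints are at minus infinity the primitive vanishes there, so only
    one corner term, two one-dimensional integrals and the double integral
    remain, which gives the second one.

    Fine tagged divisions exist by Cousin's lemma.  In one dimension this is an
    induction principle for compact intervals ([seg_induction]): a property of
    segments that passes to the union of two adjacent segments and holds for
    all small segments around each point holds for every segment.  Applying it
    in each variable in turn gives the same principle for boxes
    ([box_induction]), for gauges that need not be products of one-variable
    gauges.  The latter principle also shows that the primitive is bounded.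

    The norms are defined as real parts of suprema in the extended reals, so
    all of these must be shown finite.  For [F] this is the boundedness just
    mentioned.  For [g] the point is the comparison
    [V1 g y <= V1 g y0 + V12 g] ([V1_le]): a division of the line times the
    segment from [y0] to [y] is part of a division of the plane. *)

(** * Divisions of an abstract family of cells *)

Section divisions.
Context {R : realType} {X T : Type}.
Variables (S : T -> set X) (wf : T -> Prop) (null : set X -> Prop).

(** Segments and boxes are treated alike: with cells [T], underlying sets [S],
    well-formedness [wf] and null sets [null], [division] and [variation] are
    convertible to [division1], [V] for segments and to [division2], [V12] for
    boxes, except that the variation is taken over any cell. *)
Definition division (J : T) (n : nat) (D : 'I_n -> T) : Prop :=
  [/\ forall i, wf (D i),
      \bigcup_i S (D i) = S J &
      forall i j, i != j -> null (S (D i) `&` S (D j))].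

Definition variation (phi : T -> R) (J : T) : \bar R :=
  ereal_sup [set v | exists n (D : 'I_n -> T),
    division J D /\ v = (\sum_(i < n) `|phi (D i)|)%:E].

(** Heredity is asked only of intersections of two cells, because the measure
    of the plane is controlled only on measurable sets. *)
Definition null_hereditary : Prop := forall I I' J J',
  S I `<=` S J -> S I' `<=` S J' -> null (S J `&` S J') -> null (S I `&` S I').

Definition abut (J1 J2 J : T) : Prop :=
  S J1 `|` S J2 = S J /\ null (S J1 `&` S J2).

Definition has_fine (gam : X -> set X) (J : T) : Prop :=
  exists n (D : 'I_n -> T) (t : 'I_n -> X),
    [/\ division J D, forall i, S (D i) (t i) &
        forall i, S (D i) `<=` gam (t i)].

Lemma abutC J1 J2 J : abut J1 J2 J -> abut J2 J1 J.
Proof. by rewrite /abut setUC setIC. Qed.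

Lemma division_single J : wf J -> division J (fun _ : 'I_1 => J).
Proof.
move=> wJ; split=> //; last by move=> i j; rewrite !ord1 eqxx.
by rewrite bigcup_const //; exists ord0.
Qed.

Definition cat_fam {A : Type} n m (u : 'I_n -> A) (v : 'I_m -> A)
    (i : 'I_(n + m)) : A :=
  match fintype.split i with inl j => u j | inr k => v k end.

Lemma cat_faml {A : Type} n m (u : 'I_n -> A) (v : 'I_m -> A) j :
  cat_fam u v (lshift m j) = u j.
Proof. by rewrite /cat_fam (unsplitK (inl j)). Qed.

Lemma cat_famr {A : Type} n m (u : 'I_n -> A) (v : 'I_m -> A) k :
  cat_fam u v (rshift n k) = v k.
Proof. by rewrite /cat_fam (unsplitK (inr k)). Qed.

(** Gluing is what makes variation monotone in the cell and the existence of
    fine divisions an additive property. *)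
Lemma division_cat J1 J2 J n m (D1 : 'I_n -> T) (D2 : 'I_m -> T) :
  null_hereditary -> abut J1 J2 J -> division J1 D1 -> division J2 D2 ->
  division J (cat_fam D1 D2).
Proof.
move=> nh [cov nul] [w1 c1 n1] [w2 c2 n2].
have s1 i : S (D1 i) `<=` S J1 by rewrite -c1; exact: bigcup_sup.
have s2 i : S (D2 i) `<=` S J2 by rewrite -c2; exact: bigcup_sup.
split.
- by move=> i; case: (split_ordP i) => j ->; rewrite ?cat_faml ?cat_famr.
- rewrite -cov -c1 -c2; apply/seteqP; split=> x.
    move=> [i _]; case: (split_ordP i) => j ->; rewrite ?cat_faml ?cat_famr.
      by left; exists j.
    by right; exists j.
  move=> [] [i _ xi].
    by exists (lshift m i) => //; rewrite cat_faml.
  by exists (rshift n i) => //; rewrite cat_famr.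
- move=> i j; case: (split_ordP i) => a ->; case: (split_ordP j) => b -> ne;
    rewrite ?cat_faml ?cat_famr.
  + by apply: n1; apply: contra_neq ne => ->.
  + exact: nh (s1 _) (s2 _) nul.
  + by rewrite setIC; exact: nh (s1 _) (s2 _) nul.
  + by apply: n2; apply: contra_neq ne => ->.
Qed.

(** A division of [J1] becomes one of [J], with a larger sum, when the single
    cell [J2] is added to it. *)
Lemma variation_le phi J1 J2 J : null_hereditary -> abut J1 J2 J -> wf J2 ->
  (variation phi J1 <= variation phi J)%E.
Proof.
move=> nh ab w2; apply/ereal_supP => _ [n [D [dD ->]]].
apply: le_ereal_sup_tmp; exists (\sum_i `|phi (cat_fam D (fun _ : 'I_1 => J2) i)|)%:E.
  exists (n + 1)%N, (cat_fam D (fun _ : 'I_1 => J2)); split=> //.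
  exact: division_cat nh ab dD (division_single w2).
rewrite lee_fin big_split_ord /= -[leLHS]addr0 lerD//.
  by apply: ler_sum => i _; rewrite cat_faml.
exact: sumr_ge0.
Qed.

Lemma variation_single phi J : wf J -> (`|phi J|%:E <= variation phi J)%E.
Proof.
move=> wJ; apply: ereal_sup_ubound; exists 1%N, (fun=> J).
by rewrite big_ord1; split=> //; exact: division_single.
Qed.

Lemma has_fine_abut gam J1 J2 J : null_hereditary -> abut J1 J2 J ->
  has_fine gam J1 -> has_fine gam J2 -> has_fine gam J.
Proof.
move=> nh ab [n [D [t [dD tD fD]]]] [m [D' [t' [dD' tD' fD']]]].
exists (n + m)%N, (cat_fam D D'), (cat_fam t t'); split.
- exact: division_cat nh ab dD dD'.
- by move=> i; case: (split_ordP i) => j ->; rewrite ?cat_faml ?cat_famr.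
- by move=> i; case: (split_ordP i) => j ->; rewrite ?cat_faml ?cat_famr.
Qed.

Lemma has_fine_single gam J x :
  wf J -> S J x -> S J `<=` gam x -> has_fine gam J.
Proof.
move=> wJ Jx sJ; exists 1%N, (fun=> J), (fun=> x).
by split=> //; exact: division_single.
Qed.

(** One fine division suffices: its sum is at most [M * v], and it is as close
    to [A] as desired. *)
Lemma stieltjes_bound (gauge : (X -> set X) -> Prop) (F : X -> R)
    (phi : T -> R) (J : T) (M v A : R) :
  (forall gam, gauge gam -> has_fine gam J) ->
  0 <= M -> (forall x, `|F x| <= M) -> (variation phi J <= v%:E)%E ->
  (forall e : R, 0 < e -> exists2 gam, gauge gam &
    forall n (D : 'I_n -> T) (t : 'I_n -> X),
      division J D -> (forall i, S (D i) (t i)) ->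
      (forall i, S (D i) `<=` gam (t i)) ->
      `|\sum_(i < n) F (t i) * phi (D i) - A| < e) ->
  `|A| <= M * v.
Proof.
move=> cousin M0 FM Vv HA; apply/ler_addgt0Pr => e e0.
have [gam ggam H] := HA e e0.
have [n [D [t [dD tD fD]]]] := cousin gam ggam.
have {H} := H n D t dD tD fD; set s := \sum_(i < n) _ => sA.
have sM : `|s| <= M * v.
  apply: le_trans (ler_norm_sum _ _ _) _.
  apply: (@le_trans _ _ (M * \sum_(i < n) `|phi (D i)|)).
    rewrite mulr_sumr; apply: ler_sum => i _.
    by rewrite normrM ler_wpM2r.
  rewrite ler_wpM2l// -lee_fin; apply: le_trans Vv.
  by apply: ereal_sup_ubound; exists n, D.
rewrite -[A](subKr s) (le_trans (ler_normB _ _))// lerD// ltW//.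
Qed.

End divisions.

(** * Segments and boxes: null intersections and adjacency *)

Section segments_and_boxes.
Context {R : realType}.
Implicit Types (a b c d x y : \bar R) (I : seg R) (J : box R).

Lemma seg_setP I x : seg_set I x <-> (I.1 <= x <= I.2)%E.
Proof. by rewrite /seg_set /= in_itv. Qed.

Lemma measurable_fin_seg I I' :
  measurable [set x : R | (seg_set I `&` seg_set I') x%:E].
Proof.
rewrite -[X in measurable X]setTI; apply: measurable_realfun.EFin_measurable => //.
by apply: measurableI; exact: measurable_realfun.emeasurable_itv.
Qed.

Lemma null1_hereditary : null_hereditary (@seg_set R) null1.
Proof.
move=> I I' J J' sI sI' n0.
apply: (@subset_measure0 _ _ _ lebesgue_measure _ _ _ _ _ n0); last 1 first.
- by move=> x [? ?]; split; [exact: sI|exact: sI'].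
- exact: measurable_fin_seg.
- exact: measurable_fin_seg.
Qed.

(** The finite part of an intersection of boxes is a measurable rectangle. *)
Lemma null2E J J' : null2 (box_set J `&` box_set J') <->
  (lebesgue_measure [set x : R | (seg_set J.1 `&` seg_set J'.1) x%:E] *
   lebesgue_measure [set x : R | (seg_set J.2 `&` seg_set J'.2) x%:E] = 0)%E.
Proof.
rewrite -product_measure1E; try exact: measurable_fin_seg.
rewrite /null2; set A := mkset _; set B := _ `*` _.
suff -> : A = B by [].
by apply/seteqP; split=> [z [[? ?] [? ?]]|z [[? ?] [? ?]]].
Qed.

Lemma null2_hereditary : null_hereditary (@box_set R) null2.
Proof.
have mb J J' : measurable
    [set z : R * R | (box_set J `&` box_set J') (z.1%:E, z.2%:E)].
  rewrite (_ : mkset _ =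
      [set x : R | (seg_set J.1 `&` seg_set J'.1) x%:E] `*`
      [set x : R | (seg_set J.2 `&` seg_set J'.2) x%:E]).
    by apply: measurableX; exact: measurable_fin_seg.
  by apply/seteqP; split=> [z [[? ?] [? ?]]|z [[? ?] [? ?]]].
move=> I I' J J' sI sI' n0.
apply: (@subset_measure0 _ _ _ (lebesgue_measure \x lebesgue_measure)%E
  _ _ (mb _ _) (mb _ _) _ n0).
by move=> x [? ?]; split; [exact: sI|exact: sI'].
Qed.

Lemma null1_null2l J J' :
  null1 (seg_set J.1 `&` seg_set J'.1) -> null2 (box_set J `&` box_set J').
Proof. by move=> n0; apply/null2E; rewrite n0 mul0e. Qed.

Lemma null1_null2r J J' :
  null1 (seg_set J.2 `&` seg_set J'.2) -> null2 (box_set J `&` box_set J').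
Proof. by move=> n0; apply/null2E; rewrite n0 mule0. Qed.

Lemma abut_seg a b c : (a <= b)%E -> (b <= c)%E ->
  abut (@seg_set R) null1 (a, b) (b, c) (a, c).
Proof.
move=> ab bc; split.
  apply/seteqP; split=> x.
    case=> /seg_setP/andP[/= h1 h2]; apply/seg_setP => /=.
      by rewrite h1 (le_trans h2).
    by rewrite h2 (le_trans ab).
  move=> /seg_setP/andP[/= h1 h2]; have [xb|/ltW bx] := leP x b.
    by left; apply/seg_setP; rewrite /= h1.
  by right; apply/seg_setP; rewrite /= bx.
apply: (@subset_measure0 _ _ _ lebesgue_measure _ [set fine b]) => //.
- exact: measurable_fin_seg.
- move=> x [/seg_setP/andP[/= _ xb] /seg_setP/andP[/= bx _]].
  by have -> : b = x%:E by apply/le_anti; rewrite xb bx.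
- exact: lebesgue_measure_set1.
Qed.

Lemma abut_boxl a b c I : (a <= b)%E -> (b <= c)%E ->
  abut (@box_set R) null2 ((a, b), I) ((b, c), I) ((a, c), I).
Proof.
move=> ab bc; have [u n] := abut_seg ab bc; split; last exact: null1_null2l.
rewrite /box_set /= -u; apply/seteqP; split=> z.
  by case=> -[? ?]; split=> //; [left|right].
by case=> -[] ? ?; [left|right].
Qed.

Lemma abut_boxr a b c I : (a <= b)%E -> (b <= c)%E ->
  abut (@box_set R) null2 (I, (a, b)) (I, (b, c)) (I, (a, c)).
Proof.
move=> ab bc; have [u n] := abut_seg ab bc; split; last exact: null1_null2r.
rewrite /box_set /= -u; apply/seteqP; split=> z.
  by case=> -[? ?]; split=> //; [left|right].
by case=> ? [] ?; [left|right].
Qed.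

(** * Cousin's lemma *)

Lemma nbhs_segl x a (U : set (\bar R)) : nbhs x U -> (a < x)%E ->
  exists2 l, (a <= l < x)%E & forall y, (l < y <= x)%E -> U y.
Proof.
case: x => [x|/=|]; last by rewrite ltNge leNye.
- move=> xU; have /nbhs_ballP[e /= e0 eU] : nbhs x (fun r => U r%:E) := xU.
  move=> ax.
  exists (Order.max a (x - e)%:E).
    by rewrite le_max lexx/= gt_max ax lte_fin ltrBlDr ltrDl.
  move=> [y| |]; rewrite ?gt_max//= ?leye_eq ?andbF//.
    rewrite lte_fin lee_fin => /andP[/andP[_ h1] h2].
    by apply: eU; rewrite -ball_normE /= ger0_norm; lra.
- move=> [M [_ MU]] ay; exists (Order.max a M%:E).
    by rewrite le_max lexx/= gt_max ay ltry.
  by move=> y /andP[]; rewrite gt_max => /andP[_ My] _; exact: MU.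
Qed.

Lemma nbhs_segr x b (U : set (\bar R)) : nbhs x U -> (x < b)%E ->
  exists2 r, (x < r <= b)%E & forall y, (x <= y <= r)%E -> U y.
Proof.
case: x => [x||/=]; last 2 first.
- by rewrite ltNge leey.
- move=> [M [_ MU]] ay; exists (Order.min b (M - 1)%:E).
    by rewrite ge_min lexx/= lt_min ay ltNyr.
  move=> y /andP[_]; rewrite le_min => /andP[_ My]; apply: MU.
  by apply: le_lt_trans My _; rewrite lte_fin; lra.
- move=> xU; have /nbhs_ballP[e /= e0 eU] : nbhs x (fun r => U r%:E) := xU.
  move=> xb.
  exists (Order.min b (x + e / 2)%:E).
    by rewrite ge_min lexx/= lt_min xb lte_fin; lra.
  move=> [y| |]; rewrite ?le_min//= ?leye_eq ?andbF//.
    rewrite !lee_fin => /andP[h1 /andP[_ h2]].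
    by apply: eU; rewrite -ball_normE /= ler0_norm; lra.
Qed.

(** Let [s] be the supremum of the [x] for which [P (a, x)] holds.  The local
    hypothesis at [s], applied to a segment ending at [s], gives [P (a, s)];
    were [s < b], applying it to a segment starting at [s] would go beyond the
    supremum. *)
Lemma seg_induction (P : seg R -> Prop) :
  (forall a b c, (a <= b)%E -> (b <= c)%E -> P (a, b) -> P (b, c) -> P (a, c)) ->
  (forall x, exists2 U, nbhs x U & forall I,
     seg_wf I -> seg_set I x -> seg_set I `<=` U -> P I) ->
  forall I, seg_wf I -> P I.
Proof.
move=> Padd Ploc [a b] ab; rewrite /seg_wf /= in ab.
pose A := [set x | (a <= x <= b)%E /\ P (a, x)].
pose s := ereal_sup A.
have [U sU PU] := Ploc s.
have Aa : A a.
  split; first by rewrite lexx.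
  have [W aW PW] := Ploc a; apply: PW => [|/=|y].
  - exact: lexx.
  - by apply/seg_setP; rewrite /= lexx.
  - move=> /seg_setP /= ya; rewrite -(le_anti ya); exact: nbhs_singleton aW.
have as_ : (a <= s)%E by exact: ereal_sup_ubound.
have sb : (s <= b)%E by apply/ereal_supP => y [/andP[]].
have Ps : P (a, s).
  move: as_; rewrite le_eqVlt => /predU1P[<-|as_]; first by case: Aa.
  have [l /andP[al ls] lU] := nbhs_segl sU as_.
  have [x [/andP[ax xb] Px] lx] := ereal_sup_gt ls.
  have xs : (x <= s)%E by apply: ereal_sup_ubound; rewrite /A /= ax xb.
  apply: (Padd _ x) => //; apply: PU => //.
  - by apply/seg_setP; rewrite /= xs lexx.
  - move=> y /seg_setP/andP[/= xy ys]; apply: lU.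
    by rewrite ys (lt_le_trans lx).
move: sb; rewrite le_eqVlt => /predU1P[<-//|sb].
have [r /andP[sr rb] rU] := nbhs_segr sU sb.
suff /ereal_sup_ubound : A r by rewrite leNgt sr.
split; first by rewrite rb (le_trans as_)// ltW.
apply: (Padd _ s) => //; first exact: ltW.
apply: PU.
- exact: ltW.
- by apply/seg_setP; rewrite /= lexx ltW.
- by move=> y /seg_setP /= ?; exact: rU.
Qed.

(** For fixed [x], the segments [I'] such that [Q (I, I')] for all small [I]
    around [x] are closed under union of adjacent ones, since two neighbourhoods
    of [x] may be intersected.  Hence every [I'] is of this kind, and the
    principle in the first variable concludes.  This argument replaces the tube
    lemma. *)
Lemma box_induction (Q : box R -> Prop) :
  (forall a b c I, (a <= b)%E -> (b <= c)%E ->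
     Q ((a, b), I) -> Q ((b, c), I) -> Q ((a, c), I)) ->
  (forall a b c I, (a <= b)%E -> (b <= c)%E ->
     Q (I, (a, b)) -> Q (I, (b, c)) -> Q (I, (a, c))) ->
  (forall z, exists2 U, nbhs z U & forall J,
     box_wf J -> box_set J z -> box_set J `<=` U -> Q J) ->
  forall J, box_wf J -> Q J.
Proof.
move=> Qaddl Qaddr Qloc [I I'] [/= wI wI'].
apply: (seg_induction (P := fun I => Q (I, I'))) wI => [a b c|x]; first exact: Qaddl.
pose good I' := exists2 U, nbhs x U & forall I,
  seg_wf I -> seg_set I x -> seg_set I `<=` U -> Q (I, I').
apply: (seg_induction (P := good)) wI' => [a b c ab bc|y].
  move=> [U1 nU1 Q1] [U2 nU2 Q2]; exists (U1 `&` U2); first exact: filterI.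
  move=> K wK Kx KU; apply: (Qaddr _ b) => //.
    by apply: Q1 => // u /KU[].
  by apply: Q2 => // u /KU[].
have [W nW QW] := Qloc (x, y); case: nW => -[U1 U2] /= [nU1 nU2] UW.
exists U2 => // K wK Ky KU; exists U1 => // L wL Lx LU.
apply: QW; [by split|by split|].
by move=> [u v] [/= Lu Kv]; apply: UW; split; [exact: LU|exact: KU].
Qed.

Lemma has_fine1 gam I : gauge1 gam -> seg_wf I ->
  has_fine (@seg_set R) seg_wf null1 gam I.
Proof.
move=> ggam; apply: seg_induction => [a b c ab bc|x].
  exact: has_fine_abut null1_hereditary (abut_seg ab bc).
have [ogam gx _] := ggam x.
by exists (gam x) => [|K wK Kx]; [exact: open_nbhs_nbhs|exact: has_fine_single].
Qed.

Lemma has_fine2 gam J : gauge2 gam -> box_wf J ->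
  has_fine (@box_set R) box_wf null2 gam J.
Proof.
move=> ggam; apply: box_induction => [a b c I ab bc|a b c I ab bc|z].
- exact: has_fine_abut null2_hereditary (abut_boxl I ab bc).
- exact: has_fine_abut null2_hereditary (abut_boxr I ab bc).
have [ogam gz _] := ggam z.
by exists (gam z) => [|K wK Kz]; [exact: open_nbhs_nbhs|exact: has_fine_single].
Qed.

(** Boundedness on a box is additive and, by continuity, local. *)
Lemma continuous_bounded (F : \bar R * \bar R -> R) : continuous F ->
  exists M, forall z, `|F z| <= M.
Proof.
move=> cF.
have [M HM] : exists M, forall z, box_set whole2 z -> `|F z| <= M.
  have merge (J1 J2 J : box R) : abut (@box_set R) null2 J1 J2 J ->
      (exists M, forall z, box_set J1 z -> `|F z| <= M) ->
      (exists M, forall z, box_set J2 z -> `|F z| <= M) ->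
      exists M, forall z, box_set J z -> `|F z| <= M.
    move=> [<- _] [M1 H1] [M2 H2]; exists (Num.max M1 M2) => z.
    by case=> [/H1|/H2] h; rewrite le_max h ?orbT.
  apply: (box_induction
    (Q := fun J => exists M, forall z, box_set J z -> `|F z| <= M)).
  - by move=> a b c I ab bc; exact/merge/abut_boxl.
  - by move=> a b c I ab bc; exact/merge/abut_boxr.
  - move=> z; exists [set w | `|F z - F w| < 1].
      by have /cvgrPdist_lt := cF z; exact.
    move=> J _ _ JU; exists (`|F z| + 1) => w /JU /= h.
    rewrite -[F w](subKr (F z)) (le_trans (ler_normB _ _))// lerD// ltW//.
  - by split; exact: leNye.
exists M => z; apply: HM.
by split; apply/seg_setP; rewrite leNye leey.
Qed.

End segments_and_boxes.

(** * Hardy-Krause variation *)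

Section bounded_variation.
Context {R : realType}.
Implicit Types (a b c d x y : \bar R) (I : seg R) (J : box R).
Implicit Types (h : \bar R -> R) (g : \bar R * \bar R -> R).

Local Notation variation1 := (variation (@seg_set R) seg_wf null1).
Local Notation variation2 := (variation (@box_set R) box_wf null2).

Lemma variation1_leV h I : seg_wf I -> (variation1 (incr1 h) I <= V h)%E.
Proof.
case: I => a b ab; apply: (@le_trans _ _ (variation1 (incr1 h) (-oo%E, b))).
  apply: variation_le null1_hereditary (abutC (abut_seg _ ab)) _; exact: leNye.
by apply: variation_le null1_hereditary (abut_seg _ _) _; rewrite /seg_wf ?leNye ?leey.
Qed.

(** A box is extended to the whole plane by adding one box on each of its four
    sides in turn, the two vertical sides first. *)
Lemma variation2_leV12 g J : box_wf J -> (variation2 (incr2 g) J <= V12 g)%E.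
Proof.
have w1 : seg_wf (@whole1 R) by exact: leNye.
have lowl a b I : seg_wf I -> (a <= b)%E ->
    (variation2 (incr2 g) ((a, b), I) <= variation2 (incr2 g) ((-oo, b), I))%E.
  move=> wI ab.
  apply: variation_le null2_hereditary (abutC (abut_boxl I _ ab)) _.
    exact: leNye.
  by split=> //; exact: leNye.
have uppl b I : seg_wf I ->
    (variation2 (incr2 g) ((-oo, b), I) <= variation2 (incr2 g) (whole1, I))%E.
  move=> wI; apply: variation_le null2_hereditary (abut_boxl I _ _) _.
  - exact: leNye.
  - exact: leey.
  - by split=> //; exact: leey.
have lowr c d : (c <= d)%E -> (variation2 (incr2 g) (whole1, (c, d)) <=
    variation2 (incr2 g) (whole1, (-oo, d)))%E.
  move=> cd.
  apply: variation_le null2_hereditary (abutC (abut_boxr _ _ cd)) _.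
    exact: leNye.
  by split=> //; exact: leNye.
have uppr d : (variation2 (incr2 g) (whole1, (-oo, d)) <= V12 g)%E.
  apply: variation_le null2_hereditary (abut_boxr _ _ _) _.
  - exact: leNye.
  - exact: leey.
  - by split=> //; exact: leey.
case: J => -[a b] [c d] [/= ab cd].
by rewrite (le_trans (lowl a b _ cd ab))// (le_trans (uppl _ _ cd))//
  (le_trans (lowr _ _ cd)).
Qed.

Lemma V_ge0 h : (0 <= V h)%E.
Proof.
apply: le_trans (variation_single (@seg_set R) null1 (incr1 h) (leNye +oo : seg_wf whole1)).
by rewrite lee_fin.
Qed.

Lemma V12_ge0 g : (0 <= V12 g)%E.
Proof.
have w2 : box_wf (@whole2 R) by split; exact: leNye.
by apply: le_trans (variation_single (@box_set R) null2 (incr2 g) w2); rewrite lee_fin.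
Qed.

Lemma dist_le_V h x y : (`|h x - h y|%:E <= V h)%E.
Proof.
wlog xy : x y / (x <= y)%E.
  by move=> H; have [/H|/ltW/H//] := leP x y; rewrite distrC.
rewrite distrC.
apply: le_trans (variation1_leV h (xy : seg_wf (x, y))).
exact: (variation_single (@seg_set R) null1 (incr1 h) (xy : seg_wf (x, y))).
Qed.

Lemma division2_prod n (D : 'I_n -> seg R) I I' :
  division1 I D -> seg_wf I' -> division2 (I, I') (fun i => (D i, I')).
Proof.
move=> [wD cD nD] wI'; split.
- by move=> i; split; first exact: wD.
- rewrite /box_set /= -cD; apply/seteqP; split=> z.
    by move=> [i _ [? ?]]; split=> //; exists i.
  by move=> [[i _ ?] ?]; exists i.
- by move=> i j ij; apply: null1_null2l; exact: nD.
Qed.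

(** For each piece of a division of the line, the difference of the increments
    of [g] at the heights [y0] and [y] is the mixed increment over the piece
    times the segment between the two heights; these boxes divide a horizontal
    strip. *)
Lemma V1_le g y0 y : (V1 g y <= V1 g y0 + V12 g)%E.
Proof.
apply/ereal_supP => _ [n [D [dD ->]]].
pose u y i := incr1 (fun x => g (x, y)) (D i).
have diff c d : (c <= d)%E -> ((\sum_i `|u d i - u c i|)%:E <= V12 g)%E.
  move=> cd; apply: le_trans (variation2_leV12 g (J := (whole1, (c, d))) _).
    apply: ereal_sup_ubound; exists n, (fun i => (D i, (c, d))).
    split; first exact: division2_prod.
    congr EFin; apply: eq_bigr => i _; rewrite /u /incr1 /incr2.
    by case: (D i) => a b /=; congr `|_|; ring.
  by split=> //; exact: leNye.
have {}diff : ((\sum_i `|u y i - u y0 i|)%:E <= V12 g)%E.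
  have [/diff//|/ltW/diff] := leP y0 y.
  by under eq_bigr do rewrite distrC.
apply: (@le_trans _ _ ((\sum_i `|u y0 i|)%:E + (\sum_i `|u y i - u y0 i|)%:E)%E).
  rewrite -EFinD lee_fin -big_split /=; apply: ler_sum => i _.
  by rewrite -[leLHS](_ : `|u y0 i + (u y i - u y0 i)| = _) ?ler_normD// subrKC.
by apply: leeD => //; apply: ereal_sup_ubound; exists n, D.
Qed.

(** The bound [M] ensures that the supremum is finite, without which [supnorm]
    would be 0. *)
Lemma le_supnorm {T : Type} (F : T -> R) M z :
  (forall z, `|F z| <= M) -> `|F z| <= supnorm F.
Proof.
move=> FM; have ub : (ereal_sup (range (fun z => `|F z|%:E)) <= M%:E)%E.
  by apply/ereal_supP => _ [w _ <-]; rewrite lee_fin.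
have lb : (`|F z|%:E <= ereal_sup (range (fun z => `|F z|%:E)))%E.
  by apply: ereal_sup_ubound; exists z.
rewrite -lee_fin fineK// fin_real// (lt_le_trans _ lb) ?ltNyr//=.
by rewrite (le_lt_trans ub) ?ltry.
Qed.

Lemma V1_le_V1norm g y0 y : (V12 g < +oo)%E -> (V1 g y0 < +oo)%E ->
  (V1 g y <= (V1norm g)%:E)%E.
Proof.
move=> V12oo V1oo.
have ub : (ereal_sup (range (V1 g)) < +oo)%E.
  apply: (@le_lt_trans _ _ (V1 g y0 + V12 g)%E); last exact: lte_add_pinfty.
  by apply/ereal_supP => _ [w _ <-]; exact: V1_le.
have lb : (V1 g y <= ereal_sup (range (V1 g)))%E.
  by apply: ereal_sup_ubound; exists y.
by rewrite fineK// ge0_fin_numE// (le_trans _ lb)// V_ge0.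
Qed.

(** Exchanging the variables turns [V2] into [V1], by conversion. *)
Definition transpose g : \bar R * \bar R -> R := fun z => g (z.2, z.1).

Lemma V12_transpose g : (V12 (transpose g) <= V12 g)%E.
Proof.
apply/ereal_supP => _ [n [D [[wD cD nD] ->]]].
apply: ereal_sup_ubound; exists n, (fun i => ((D i).2, (D i).1)); split.
  split.
  - by move=> i; have [] := wD i.
  - apply/seteqP; split=> z.
      by move=> _; split; apply/seg_setP; rewrite leNye leey.
    move=> [z1 z2].
    have [i _ [? ?]] : (\bigcup_i box_set (D i)) (z.2, z.1) by rewrite cD; split.
    by exists i.
  - by move=> i j /nD /null2E h; apply/null2E; rewrite muleC.
congr EFin; apply: eq_bigr => i _; case: (D i) => -[a b] [c d] /=.
by rewrite /transpose /=; congr `|_|; ring.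
Qed.

(** Boundedness of [g] follows by going from [(x0, y0)] to [(x0, y)] and then
    to [(x, y)], each step costing at most a one-variable variation. *)
Lemma HKBV_bounds g : HKBV g ->
  [/\ forall z, `|g z| <= supnorm g,
      forall y, (V1 g y <= (V1norm g)%:E)%E,
      forall x, (V2 g x <= (V2norm g)%:E)%E &
      (V12 g <= (V12norm g)%:E)%E].
Proof.
move=> [v12 [x0 [y0 [v1 v2]]]].
have B1 y : (V1 g y <= (V1norm g)%:E)%E by exact: V1_le_V1norm v1.
have B2 x : (V2 g x <= (V2norm g)%:E)%E.
  exact: (V1_le_V1norm x (le_lt_trans (V12_transpose g) v12) v2).
split=> // [z|]; last by rewrite fineK// ge0_fin_numE// V12_ge0.
apply: (@le_supnorm _ _ (`|g (x0, y0)| + V1norm g + V2norm g)) => -[x y].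
have : `|g (x, y) - g (x0, y)| <= V1norm g.
  rewrite -lee_fin; apply: le_trans (B1 y); exact: (dist_le_V (fun x => g (x, y))).
have : `|g (x0, y) - g (x0, y0)| <= V2norm g.
  rewrite -lee_fin; apply: le_trans (B2 x0); exact: (dist_le_V (fun y => g (x0, y))).
move=> h2 h1.
have -> : g (x, y) = g (x0, y0) + (g (x, y) - g (x0, y))
  + (g (x0, y) - g (x0, y0)) by ring.
by rewrite (le_trans (ler_normD _ _))// lerD// (le_trans (ler_normD _ _))// lerD.
Qed.

(** * Bounds for the integrals *)

Lemma HS1_bound (F h : \bar R -> R) a b M v : (a <= b)%E ->
  (forall x, `|F x| <= M) -> (V h <= v%:E)%E -> `|HS1 F h a b| <= M * v.
Proof.
move=> ab FM hv; have M0 : 0 <= M := le_trans (normr_ge0 _) (FM a).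
rewrite /HS1; case: xgetP => [A _ HA|_]; last first.
  by rewrite normr0 mulr_ge0// -lee_fin (le_trans _ hv)// V_ge0.
apply: (stieltjes_bound _ M0 FM _ HA) => [gam ggam|].
  exact: has_fine1.
exact: le_trans (variation1_leV h (ab : seg_wf (a, b))) hv.
Qed.

Lemma HS2_bound (F g : \bar R * \bar R -> R) a b c d M v :
  (a <= b)%E -> (c <= d)%E ->
  (forall z, `|F z| <= M) -> (V12 g <= v%:E)%E -> `|HS2 F g a b c d| <= M * v.
Proof.
move=> ab cd FM gv; have M0 : 0 <= M := le_trans (normr_ge0 _) (FM (a, c)).
have wJ : box_wf ((a, b), (c, d)) by split.
rewrite /HS2; case: xgetP => [A _ HA|_]; last first.
  by rewrite normr0 mulr_ge0// -lee_fin (le_trans _ gv)// V12_ge0.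
apply: (stieltjes_bound _ M0 FM _ HA) => [gam ggam|].
  exact: has_fine2.
exact: le_trans (variation2_leV12 g wJ) gv.
Qed.

Lemma Ac_primitive (f : distribution) : Ac f -> Bc (primitive f : _ -> R).
Proof.
move=> [F BF fF]; rewrite /primitive.
by case: xgetP => [G _ []//|/(_ F)]; case.
Qed.

Lemma primitive_bound (f : distribution) (z : \bar R * \bar R) : Ac f ->
  `|primitive f z| <= anorm f.
Proof.
by move=> /Ac_primitive[/continuous_bounded[M HM] _]; exact: le_supnorm HM.
Qed.

End bounded_variation.

(** * The inequality *)

Theorem proposition8p1 (R : realType) (f : @distribution R)
    (g : \bar R * \bar R -> R) (hf : Ac f) (hg : HKBV g) :
  (forall a b c d : \bar R, (a <= b)%E -> (c <= d)%E ->
     `|prod_integral f g a b c d| <=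
       anorm f * (4 * supnorm g + 2 * V1norm g + 2 * V2norm g + V12norm g)) /\
  (forall x y : \bar R,
     `|prod_integral f g -oo%E x -oo%E y| <=
       anorm f * (supnorm g + V1norm g + V2norm g + V12norm g)) /\
  anorm f * (supnorm g + V1norm g + V2norm g + V12norm g)
    = anorm f * bvnorm g.
Proof.
have [g_sup g_V1 g_V2 g_V12] := HKBV_bounds hg.
have [_ F0] := Ac_primitive hf.
have FM z := primitive_bound z hf.
have Fg z : `|primitive f z * g z| <= anorm f * supnorm g.
  by rewrite normrM ler_pM.
have I1 y a b : (a <= b)%E ->
    `|HS1 (fun x => primitive f (x, y)) (fun x => g (x, y)) a b| <=
      anorm f * V1norm g.
  by move=> ab; apply: HS1_bound ab _ (g_V1 y) => x; exact: FM.
have I2 x c d : (c <= d)%E ->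
    `|HS1 (fun y => primitive f (x, y)) (fun y => g (x, y)) c d| <=
      anorm f * V2norm g.
  by move=> cd; apply: HS1_bound cd _ (g_V2 x) => y; exact: FM.
have I12 a b c d : (a <= b)%E -> (c <= d)%E ->
    `|HS2 (primitive f) g a b c d| <= anorm f * V12norm g.
  by move=> ab cd; exact: HS2_bound.
split; [|split] => // [a b c d ab cd|x y].
- rewrite /prod_integral /=.
  have := (Fg (a, c), Fg (b, d), Fg (a, d), Fg (b, c)).
  have := (I1 d a b ab, I1 c a b ab, I2 b c d cd, I2 a c d cd, I12 a b c d ab cd).
  move=> [[[[]]]] /ler_normlP[? ?] /ler_normlP[? ?] /ler_normlP[? ?]
    /ler_normlP[? ?] /ler_normlP[? ?].
  move=> [[[]]] /ler_normlP[? ?] /ler_normlP[? ?] /ler_normlP[? ?]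
    /ler_normlP[? ?].
  rewrite !mulrDr; apply/ler_normlP; split; lra.
(* an integral of the zero function is bounded by 0 times the variation *)
- have HS0 (G : \bar R -> R) h b : (V h < +oo)%E -> (forall t, G t = 0) ->
      HS1 G h -oo%E b = 0.
    move=> hoo G0; apply/normr0_eq0/le_anti; rewrite normr_ge0 andbT.
    rewrite -[leRHS](mul0r (fine (V h))); apply: HS1_bound.
    + exact: leNye.
    + by move=> t; rewrite G0 normr0.
    + by rewrite fineK// ge0_fin_numE// V_ge0.
  have xl := leNye x; have yl := leNye y.
  have V1oo t : (V1 g t < +oo)%E := le_lt_trans (g_V1 t) (ltry _).
  have V2oo t : (V2 g t < +oo)%E := le_lt_trans (g_V2 t) (ltry _).
  rewrite /prod_integral /= !(F0 _).1 !(F0 _).2 !mul0r.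
  rewrite (HS0 _ _ _ (V1oo -oo%E)); last by move=> t; exact: (F0 _).2.
  rewrite (HS0 _ _ _ (V2oo -oo%E)); last by move=> t; exact: (F0 _).1.
  have := (Fg (x, y), I1 y _ _ xl, I2 x _ _ yl, I12 _ _ _ _ xl yl).
  move=> [[[]]] /ler_normlP[? ?] /ler_normlP[? ?] /ler_normlP[? ?]
    /ler_normlP[? ?].
  rewrite !mulrDr; apply/ler_normlP; split; lra.
Qed.
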